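(* Let $s>0$, $t>0$, $0<q<1$, and let $T=T(1,sq,q^2,tq^3,q^4,sq^5,q^6,tq^7,\ldots)$ be the weighted shift operator whose $k$-th weight $w_k$ is $q^{k-1}$ for $k$ odd, $sq^{k-1}$ for $k\equiv 2\pmod 4$, and $tq^{k-1}$ for $k\equiv 0\pmod 4$. Let $\{c_n\}_{n\ge1}$ be the coefficients of the entire function $$F_T(z)=\det\big(I-z\,\mathrm{Re}(T)\big)=1+\sum_{k=1}^\infty\Big(\frac{-1}{4}\Big)^k c_k z^{2k},\qquad c_k=\sum w_{i_1}^2w_{i_2}^2\cdots w_{i_k}^2,$$ the sum being over all $1\le i_1<i_2<\cdots<i_k<\infty$ with $i_{j+1}-i_j\ge 2$ for $1\le j\le k-1$. Then $$c_1=\frac{1}{1-q^4}+ \frac{q^2(s^2+t^2q^4)}{1-q^8},$$ $$c_2=\frac{q^{4}}{(1-q^{16})(1-q^4)}\bigg(1+q^8+q^6(s^2+t^2q^8)+\frac{t^2q^2(1+q^{12}+s^2q^2+s^2q^{10}+t^2q^{14})+s^2q^6(1+q^4+s^2q^2)}{1+q^4}\bigg),$$ and for all $n\ge 1$, $$c_{n+2}=\frac{q^{8n+4}}{1-q^{8n+16}}\Big(t^2q^{2n+2}(1+s^2q^2)d_n+t^2q^{2n+12}d_{n+1}+c_n+q^4(1+q^4+s^2q^2)c_{n+1} \Big),$$ where $\{d_n\}_{n\ge1}$ is the sequence $d_n=\sum u_{i_1}^2\cdots u_{i_n}^2$ (sum over all $1\le i_1<\cdots<i_n<\infty$ with $i_{j+1}-i_j\ge2$)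 associated with the weights $(u_1,u_2,\ldots)=(s,q,tq^2,q^3,sq^4,q^5,tq^6,q^7,\ldots)$, i.e. $u_k=q^{k-1}$ for $k$ even, $u_k=sq^{k-1}$ for $k\equiv1\pmod4$, and $u_k=tq^{k-1}$ for $k\equiv3\pmod 4$.
   Context: For a bounded sequence of weights $(w_1,w_2,\ldots)$, $T(w_1,w_2,\ldots)$ denotes the bounded operator on $\ell^2(\mathbb{N})$, $\mathbb{N}=\{1,2,\ldots\}$, with standard orthonormal basis $\{e_k\}_{k\ge1}$, given by $Te_k=w_ke_{k+1}$. $\mathrm{Re}(T)=\frac{T+T^*}{2}$. The equality of the determinant with the power series with these coefficients $c_k$ is a known result of Stout for Hilbert–Schmidt weighted shifts, and the $c_k$ may be taken as defined by the displayed sums. *)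

(* Defs.v *)
From HB Require Import structures.
From mathcomp Require Import all_boot all_order all_algebra.
From mathcomp Require Import all_classical all_reals all_analysis.

Set Implicit Arguments.
Unset Strict Implicit.
Unset Printing Implicit Defensive.

Import Order.TTheory GRing.Theory Num.Theory.

Local Open Scope classical_set_scope.
Local Open Scope ring_scope.

(* Weight sequences are functions on nat read at the indices 1, 2, ...; the
   value at 0 is never used. *)

(* The multi-indices 1 <= i_1 < ... < i_k with i_(j+1) - i_j >= 2. *)
Definition gap2_indices (k : nat) : set (k.-tuple nat) :=
  [set i : k.-tuple nat |
    all (fun a => 0 < a)%N i && sorted (fun a b => a + 2 <= b)%N i].
Arguments gap2_indices : clear implicits.

Definition shift_coef_sum (R : realType) (w : nat -> R) (k : nat) : \bar R :=
  (\esum_(i in gap2_indices k) (\prod_(j < k) w (tnth i j) ^+ 2)%:E)%E.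

(* The coefficient c_k in
     det (I - z Re T) = 1 + \sum_(k >= 1) (-1/4)^k c_k z^(2k)
   for the weighted shift T e_k = w_k e_(k+1). It is the sum above whenever
   that sum is finite ([fine] sends infinite values to 0). *)
Definition shift_coef (R : realType) (w : nat -> R) (k : nat) : R :=
  fine (shift_coef_sum w k).

(* (1, sq, q^2, tq^3, q^4, sq^5, q^6, tq^7, ...) *)
Definition w_weight (R : realType) (s t q : R) (k : nat) : R :=
  if odd k then q ^+ k.-1
  else if (k %% 4 == 2)%N then s * q ^+ k.-1
  else t * q ^+ k.-1.

(* (s, q, tq^2, q^3, sq^4, q^5, tq^6, q^7, ...) *)
Definition u_weight (R : realType) (s t q : R) (k : nat) : R :=
  if ~~ odd k then q ^+ k.-1
  else if (k %% 4 == 1)%N then s * q ^+ k.-1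
  else t * q ^+ k.-1.

(* Main.v *)
(* Splitting the multi-indices by whether they contain the index 1, the
   generating functions F_m(x) of the coefficients attached to the shifted
   weights (w_(m+1), w_(m+2), ...) satisfy F_m = F_(m+1) + w_(m+1)^2 x F_(m+2).
   Since w_(k+4) = q^4 w_k and w_(k+1) = q u_k, we have F_4(x) = F_0(q^8 x),
   F_1(x) = D(q^2 x) and F_5(x) = D(q^10 x), where D is the generating function
   of the d_n. Eliminating F_1, F_2 and F_3 expresses F_0(x) through F_0(q^8 x)
   and D(q^10 x); comparing coefficients gives the recurrence, which also holds
   at n = 0 (with c_0 = d_0 = 1) and then yields c_2. *)
Require Import Defs.
From HB Require Import structures.
From mathcomp Require Import all_boot all_order all_algebra.
From mathcomp Require Import all_classical all_reals all_analysis.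
From mathcomp Require Import zify ring lra.

Import Order.TTheory GRing.Theory Num.Theory.
Local Open Scope ring_scope.

Lemma esumZl {R : realType} (T : choiceType) (D : set T) (a : T -> \bar R)
    (x : R) :
  0 <= x -> (forall i, 0%E <= a i)%E ->
  (\esum_(i in D) (x%:E * a i) = x%:E * \esum_(i in D) a i)%E.
Proof.
move=> x0 a0; rewrite /esum -ereal_supZl//; last first.
  by apply/set0P; exists (\sum_(i \in set0) a i)%E, set0 => //; exact: fsets_set0.
congr ereal_sup; apply/seteqP; split => y /=.
  move=> [A DA <-]; exists (\sum_(i \in A) a i)%E; first by exists A.
  by rewrite ge0_mule_fsumr.
by move=> [_ [A DA <-] <-]; exists A => //; rewrite ge0_mule_fsumr.
Qed.

(** * Coefficient sums in the extended reals *)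

Lemma shift_coef_sumE {R : realType} (w : nat -> R) (k : nat) :
  shift_coef_sum w k =
  (\esum_(i in gap2_indices k) (\prod_(a <- i) w a ^+ 2)%:E)%E.
Proof. by apply: eq_esum => i _; rewrite [in RHS]big_tuple. Qed.

Lemma prod_sqr_ge0 {R : realDomainType} (w : nat -> R) (s : seq nat) :
  0 <= \prod_(a <- s) w a ^+ 2.
Proof. by apply: prodr_ge0 => a _; exact: sqr_ge0. Qed.

Lemma shift_coef_sum_ge0 {R : realType} (w : nat -> R) (k : nat) :
  (0 <= shift_coef_sum w k)%E.
Proof.
by rewrite shift_coef_sumE; apply: esum_ge0 => i _; rewrite lee_fin prod_sqr_ge0.
Qed.

Lemma shift_coef_sum0 {R : realType} (w : nat -> R) : shift_coef_sum w 0 = 1%E.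
Proof.
rewrite shift_coef_sumE (_ : gap2_indices 0 = [set [tuple]]%classic).
  by rewrite esum_set1 ?big_nil// lee_fin.
by apply/seteqP; split => i; rewrite [i]tuple0.
Qed.

Lemma shift_coef_sumZ {R : realType} {x : R} {w v : nat -> R} (k : nat) :
  (forall i, (0 < i)%N -> v i = x * w i) ->
  shift_coef_sum v k = ((x ^+ (2 * k))%:E * shift_coef_sum w k)%E.
Proof.
move=> vE; rewrite !shift_coef_sumE exprM -esumZl; last 2 first.
- by rewrite exprn_ge0// sqr_ge0.
- by move=> i; rewrite lee_fin prod_sqr_ge0.
apply: eq_esum => i /andP[/allP i_gt0 _]; rewrite -EFinM; congr EFin.
rewrite (eq_big_seq (fun a => x ^+ 2 * w a ^+ 2)) => [|a /i_gt0 a_gt0]; last first.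
  by rewrite vE// exprMn.
by rewrite big_split/= big_const_seq count_predT size_tuple iter_mulr_1.
Qed.

Lemma shift_coef_sumS {R : realType} (w : nat -> R) (k : nat) :
  (shift_coef_sum w k.+1 = shift_coef_sum (w \o succn) k.+1
     + (w 1%N ^+ 2)%:E * shift_coef_sum (fun i => w (i + 2)%N) k)%E.
Proof.
pose up (i : k.+1.-tuple nat) := [tuple of map succn i].
pose one (i : k.-tuple nat) := [tuple of 1%N :: map (addn^~ 2%N) i].
pose G (i : k.+1.-tuple nat) := (\prod_(a <- i) w a ^+ 2)%:E.
have G_ge0 i : (0 <= G i)%E by rewrite lee_fin prod_sqr_ge0.
have trans : transitive (fun a b => a + 2 <= b)%N by move=> b a c; lia.
have sorted_up s : sorted (fun a b => a + 2 <= b)%N (map succn s) =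
    sorted (fun a b => a + 2 <= b)%N s.
  by rewrite sorted_map; apply: eq_sorted.
have sorted_add2 s : sorted (fun a b => a + 2 <= b)%N (map (addn^~ 2%N) s) =
    sorted (fun a b => a + 2 <= b)%N s.
  by rewrite sorted_map; apply: eq_sorted => a b /=; lia.
rewrite [LHS]shift_coef_sumE
  (esumID [set i : k.+1.-tuple nat | (1 < thead i)%N]%classic)
  => [|i _]; last exact: G_ge0.
congr (_ + _)%E.
- rewrite shift_coef_sumE (reindex_esum (gap2_indices k.+1) _ up) => [|]; last first.
    split.
    + move=> i /= /andP[i0 si]; split; last first.
        by rewrite /thead tnth_map; exact: (all_tnthP i0).
      by rewrite /gap2_indices /= all_map sorted_up si andbT; apply/allP.
    + move=> i j _ _ /(congr1 val)/= /inj_map ij; apply/val_inj/ij; exact: succn_inj.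
    (* Surjectivity of [up]: the preimage lowers each entry by 1. It stays positive because the
       entries increase from a head greater than 1. *)
    + move=> i [/= /andP[i0 si] i1].
      have iE : map succn (map predn i) = i.
        by rewrite -map_comp -[RHS]map_id; apply/eq_in_map => a /(allP i0)/=; lia.
      exists [tuple of map predn i]; last exact/val_inj.
      move: si i1; rewrite -{1}iE sorted_up => si i1.
      rewrite /gap2_indices /= si andbT all_map.
      move: i0 si i1 {iE}; case/tupleP: i => a i /=; rewrite theadE.
      move=> _ + a1; rewrite (path_sortedE trans) => /andP[+ _].
      rewrite all_map -subn1 subn_gt0 a1/=; apply: sub_all => b /=; lia.
  by apply: eq_esum => i _; rewrite /G big_map.
- rewrite shift_coef_sumE -esumZl ?sqr_ge0//; last first.
    by move=> i; rewrite lee_fin prod_sqr_ge0.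
  rewrite (reindex_esum (gap2_indices k) _ one) => [|]; last first.
    split.
    + move=> i /= /andP[i0 si]; rewrite /= theadE; split => //.
      rewrite /gap2_indices /= (path_sortedE trans) sorted_add2 si !all_map andbT.
      by apply/andP; split; apply: sub_all i0 => a /=; lia.
    + move=> i j _ _ /(congr1 val)/= [] /inj_map ij; apply/val_inj/ij; exact: addIn.
    (* Surjectivity of [one]: a positive head that is not above 1 equals 1, so by transitivity of
       the gap relation all later entries are at least 3 and can be lowered by 2. *)
    + move=> + []; case/tupleP => a i; rewrite /gap2_indices /= theadE.
      move=> /andP[/andP[a0 _]]; rewrite (path_sortedE trans) => /andP[ai si] /negP a1.
      have {a0 a1}aE : a = 1%N by lia.
      have iE : map (addn^~ 2%N) (map (subn^~ 2%N) i) = i.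
        rewrite -map_comp -[RHS]map_id; apply/eq_in_map => b /(allP ai)/=; lia.
      exists [tuple of map (subn^~ 2%N) i]; last by apply/val_inj; rewrite /= iE aE.
      rewrite /gap2_indices /= -sorted_add2 iE si andbT all_map.
      by apply: sub_all ai => b /=; lia.
  by apply: eq_esum => i _; rewrite /G /= big_cons big_map EFinM.
Qed.

(** * Finiteness of the coefficient sums *)

Lemma esum_tuple {R : realType} {a : nat -> R} {M : R} (k : nat) :
  (forall n, 0 <= a n) -> (\esum_(n in [set: nat]) (a n)%:E)%E = M%:E ->
  (\esum_(i in [set: k.-tuple nat]) (\prod_(n <- i) a n)%:E)%E = (M ^+ k)%:E.
Proof.
move=> a0 aM; elim: k => [|k IHk].
  rewrite (_ : [set: _] = [set [tuple]])%classic.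
    by rewrite esum_set1 ?big_nil// lee_fin.
  by apply/seteqP; split => i // _; rewrite [i]tuple0.
have prod0 (s : seq nat) : 0 <= \prod_(n <- s) a n by exact: prodr_ge0.
(* Peeling off the first entry turns the sum over tuples into a double sum, which factors. *)
pose e (p : nat * k.-tuple nat) := [tuple of p.1 :: p.2].
rewrite (reindex_esum ([set: nat] `*`` fun=> [set: k.-tuple nat])%classic _ e)
  => [|]; last first.
  split => //.
  + by move=> [n i] [m j] _ _ /(congr1 val)/= [-> /val_inj ->].
  + by move=> i _; case/tupleP: i => n i; exists (n, i) => //; exact/val_inj.
transitivity (\esum_(n in [set: nat]) \esum_(i in [set: k.-tuple nat])
    ((a n)%:E * (\prod_(m <- i) a m)%:E))%E.
  rewrite esum_esum => [|n i _ _]; last by rewrite mule_ge0 ?lee_fin.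
  by apply: eq_esum => -[n i] _; rewrite /= big_cons EFinM.
have M0 : 0 <= M by rewrite -lee_fin -aM; apply: esum_ge0 => n _; rewrite lee_fin.
rewrite exprSr EFinM -aM -esumZl ?exprn_ge0//.
apply: eq_esum => n _; rewrite esumZl// => [|i]; last by rewrite lee_fin.
by rewrite IHk muleC.
Qed.

(** Dropping the order and gap conditions bounds the sum by the [k]-th power of the total of the
    [w n ^+ 2], which a geometric series of ratio [q ^+ 2] dominates. That total includes [n = 0],
    so the bound on [w] is assumed there too. *)
Lemma shift_coef_sum_fin_num {R : realType} {w : nat -> R} {M q : R} (k : nat) :
  0 < q < 1 -> (forall i, `|w i| <= M * q ^+ i) ->
  shift_coef_sum w k \is a fin_num.
Proof.
move=> /andP[q0 q1] wM.
have w0 n : (0 <= (w n ^+ 2)%:E)%E by rewrite lee_fin sqr_ge0.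
have w_fin : (\esum_(n in [set: nat]) (w n ^+ 2)%:E)%E \is a fin_num.
  rewrite ge0_fin_numE ?esum_ge0// -nneseries_esumT//.
  apply: (@le_lt_trans _ _ (M ^+ 2 / (1 - q ^+ 2))%:E); last exact: ltry.
  apply: lime_le; first by apply: is_cvg_nneseries => n _ _.
  apply: nearW => n; rewrite sumEFin lee_fin.
  have q2 : 0 < q ^+ 2 < 1 by rewrite exprn_gt0//= expr_lt1// ltW.
  move/andP: q2 => [q20 q21].
  apply: le_trans (geometric_le_lim n (sqr_ge0 M) q20 _); last first.
    by rewrite ger0_norm ?ltW.
  apply: ler_sum => i _; rewrite /= -exprM mulnC exprM -exprMn -real_normK ?num_real//.
  by rewrite lerXn2r// nnegrE (le_trans _ (wM i)).
rewrite ge0_fin_numE ?shift_coef_sum_ge0// shift_coef_sumE.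
set W := (\esum_(n in _) _)%E in w_fin.
have wk := esum_tuple k (fun n => sqr_ge0 (w n)) (esym (fineK w_fin)).
(* Extending the summand by zero compares the sum over admissible tuples with the sum over all
   tuples. *)
apply: le_lt_trans (ltry (fine W ^+ k)); rewrite -wk esum_mkcond.
by apply: le_esum => i _; case: ifP => _ //; rewrite lee_fin prod_sqr_ge0.
Qed.

(** * Real-valued coefficients *)

Lemma shift_coef0 {R : realType} (w : nat -> R) : shift_coef w 0 = 1.
Proof. by rewrite /shift_coef shift_coef_sum0. Qed.

Lemma shift_coefZ {R : realType} {x : R} {w v : nat -> R} (k : nat) :
  (forall i, (0 < i)%N -> v i = x * w i) -> shift_coef_sum w k \is a fin_num ->
  shift_coef v k = x ^+ (2 * k) * shift_coef w k.
Proof.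
by move=> vE wk; rewrite /shift_coef (shift_coef_sumZ k vE) fineM.
Qed.

Lemma geometric_dominated_shift {R : realType} {w : nat -> R} {M q : R} (m : nat) :
  (forall i, `|w i| <= M * q ^+ i) ->
  forall i, `|w (i + m)%N| <= M * q ^+ m * q ^+ i.
Proof. by move=> wM i; rewrite -mulrA -exprD addnC. Qed.

(** Coefficient form of the recurrence for the F_m; geometric domination makes every sum finite, so
    [fine] respects the sum and the product. *)
Lemma shift_coefS {R : realType} {w : nat -> R} {M q : R} (m k : nat) :
  0 < q < 1 -> (forall i, `|w i| <= M * q ^+ i) ->
  let f m := shift_coef (fun i => w (i + m)%N) in
  f m k.+1 = f m.+1 k.+1 + w m.+1 ^+ 2 * f m.+2 k.
Proof.
move=> q01 wM f; rewrite /f /shift_coef shift_coef_sumS.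
have fin n l : shift_coef_sum (fun i => w (i + n)%N) l \is a fin_num.
  exact: shift_coef_sum_fin_num q01 (geometric_dominated_shift _ wM).
rewrite (_ : _ \o succn = fun i => w (i + m.+1)%N); last first.
  by apply/funext => i /=; rewrite addSnnS.
rewrite (_ : (fun i => w (i + 2 + m)%N) = fun i => w (i + m.+2)%N); last first.
  by apply/funext => i; congr w; lia.
by rewrite fineD ?fin_numM// fineM.
Qed.

(** * The two weight sequences *)

Lemma geometric_weight_le {R : realType} (a b q : R) (i : nat) :
  0 <= a <= b -> 0 < q < 1 -> `|a * q ^+ i.-1| <= b / q * q ^+ i.
Proof.
move=> /andP[a0 ab] /andP[q0 q1].
rewrite ger0_norm ?mulr_ge0 ?exprn_ge0 ?(ltW q0)//.
(* At [i = 0] the exponent [i.-1] is truncated to 0, and the bound follows from [q^-1] being at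
   least 1. *)
case: i => [|i] /=; last first.
  by rewrite exprS mulrA mulfVK ?gt_eqF// ler_wpM2r ?exprn_ge0 ?(ltW q0).
rewrite !expr0 !mulr1 (le_trans ab)// ler_peMr ?(le_trans a0 ab)//.
by rewrite invf_ge1 ?(ltW q1).
Qed.

Lemma w_weight_le {R : realType} {s t q : R} (i : nat) :
  0 < s -> 0 < t -> 0 < q < 1 ->
  `|w_weight s t q i| <= (1 + s + t) / q * q ^+ i.
Proof.
move=> s0 t0 q01; rewrite /w_weight; case: ifP => _; last case: ifP => _.
- by rewrite -[q ^+ i.-1]mul1r geometric_weight_le//; lra.
- by rewrite geometric_weight_le//; lra.
- by rewrite geometric_weight_le//; lra.
Qed.

Lemma u_weight_le {R : realType} {s t q : R} (i : nat) :
  0 < s -> 0 < t -> 0 < q < 1 ->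
  `|u_weight s t q i| <= (1 + s + t) / q * q ^+ i.
Proof.
move=> s0 t0 q01; rewrite /u_weight; case: ifP => _; last case: ifP => _.
- by rewrite -[q ^+ i.-1]mul1r geometric_weight_le//; lra.
- by rewrite geometric_weight_le//; lra.
- by rewrite geometric_weight_le//; lra.
Qed.

Lemma w_weight_add4 {R : realType} (s t q : R) (i : nat) :
  (0 < i)%N -> w_weight s t q (i + 4) = q ^+ 4 * w_weight s t q i.
Proof.
case: i => // i _; rewrite /w_weight oddD addbF modnDr !addSn /= exprD.
by do !case: ifP => _; ring.
Qed.

Lemma w_weight_add1 {R : realType} (s t q : R) (i : nat) :
  (0 < i)%N -> w_weight s t q (i + 1) = q * u_weight s t q i.
Proof.
case: i => // i _; rewrite /w_weight /u_weight addn1.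
rewrite [odd i.+2]/= -[odd i.+1]/(~~ odd i) /= exprS.
have -> : (i.+2 %% 4 == 2)%N = (i.+1 %% 4 == 1)%N by lia.
by do !case: ifP => _; ring.
Qed.

Theorem theorem3p2 (R : realType) (s t q : R)
    (s_gt0 : 0 < s) (t_gt0 : 0 < t) (q_gt0 : 0 < q) (q_lt1 : q < 1) :
  let c := shift_coef (w_weight s t q) in
  let d := shift_coef (u_weight s t q) in
  (forall k : nat, (1 <= k)%N ->
     shift_coef_sum (w_weight s t q) k \is a fin_num /\
     shift_coef_sum (u_weight s t q) k \is a fin_num) /\
  c 1%N = 1 / (1 - q ^+ 4)
          + q ^+ 2 * (s ^+ 2 + t ^+ 2 * q ^+ 4) / (1 - q ^+ 8) /\
  c 2%N = q ^+ 4 / ((1 - q ^+ 16) * (1 - q ^+ 4)) *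
    (1 + q ^+ 8 + q ^+ 6 * (s ^+ 2 + t ^+ 2 * q ^+ 8)
     + (t ^+ 2 * q ^+ 2 *
          (1 + q ^+ 12 + s ^+ 2 * q ^+ 2 + s ^+ 2 * q ^+ 10
           + t ^+ 2 * q ^+ 14)
        + s ^+ 2 * q ^+ 6 * (1 + q ^+ 4 + s ^+ 2 * q ^+ 2))
       / (1 + q ^+ 4)) /\
  (forall n : nat, (1 <= n)%N ->
     c (n + 2)%N = q ^+ (8 * n + 4) / (1 - q ^+ (8 * n + 16)) *
       (t ^+ 2 * q ^+ (2 * n + 2) * (1 + s ^+ 2 * q ^+ 2) * d n
        + t ^+ 2 * q ^+ (2 * n + 12) * d (n + 1)%N
        + c n
        + q ^+ 4 * (1 + q ^+ 4 + s ^+ 2 * q ^+ 2) * c (n + 1)%N)).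

Proof.
move=> c d; set w := w_weight s t q in c *; set u := u_weight s t q in d *.
have q01 : 0 < q < 1 by rewrite q_gt0.
have w_le i := w_weight_le i s_gt0 t_gt0 q01.
have u_le i := u_weight_le i s_gt0 t_gt0 q01.
have w_fin k := shift_coef_sum_fin_num k q01 w_le.
have u_fin k := shift_coef_sum_fin_num k q01 u_le.
(* [f m k] is the coefficient of x^k in F_m. *)
pose f m := shift_coef (fun i => w (i + m)%N).
have fS m k : f m k.+1 = f m.+1 k.+1 + w m.+1 ^+ 2 * f m.+2 k.
  exact: shift_coefS q01 w_le.
have f_0 m : f m 0%N = 1 by exact: shift_coef0.
have f0 k : f 0%N k = c k.
  by congr shift_coef; apply/funext => i; rewrite addn0.
have f1 k : f 1%N k = q ^+ (2 * k) * d k.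
  by apply: shift_coefZ => // i; exact: w_weight_add1.
have f4 k : f 4%N k = q ^+ (8 * k) * c k.
  rewrite -[8%N]/(4 * 2)%N -mulnA exprM.
  by apply: shift_coefZ => // i; exact: w_weight_add4.
have f5 k : f 5%N k = q ^+ (10 * k) * d k.
  rewrite -[10%N]/(5 * 2)%N -mulnA exprM.
  apply: shift_coefZ => // i i0.
  have -> : (i + 5 = i + 1 + 4)%N by rewrite -addnA.
  by rewrite [w _]w_weight_add4 ?addn_gt0 ?orbT// w_weight_add1// mulrA -exprSr.
have [w1 w2 w3 w4] :
    [/\ w 1%N = 1, w 2%N = s * q, w 3%N = q ^+ 2 & w 4%N = t * q ^+ 3].
  by rewrite /w /w_weight /= !expr0.
have q_ne (k : nat) : 1 - q ^+ k.+1 != 0.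
  by rewrite subr_eq0 eq_sym lt_eqF// exprn_ilt1// ltW.
have c1_eq : c 1%N * (1 - q ^+ 8)
    = 1 + q ^+ 4 + s ^+ 2 * q ^+ 2 + t ^+ 2 * q ^+ 6.
  have := fS 0%N 0%N; rewrite (fS 1%N) (fS 2%N) (fS 3%N) !f_0 f0 f4 w1 w2 w3 w4 muln1.
  by move: (c 1%N) => x xE; rewrite mulrBr mulr1 {1}xE; ring.
have c_eq n : c n.+2 * (1 - q ^+ (8 * n + 16)) = q ^+ (8 * n + 4) *
    (t ^+ 2 * q ^+ (2 * n + 2) * (1 + s ^+ 2 * q ^+ 2) * d n
     + t ^+ 2 * q ^+ (2 * n + 12) * d n.+1 + c n
     + q ^+ 4 * (1 + q ^+ 4 + s ^+ 2 * q ^+ 2) * c n.+1).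
  have := fS 0%N n.+1.
  (* Unfolding down to F_4 and F_5 leaves only values of [c] and [d]; the term [f 4 n.+2] supplies
     the factor [1 - q ^+ (8 * n + 16)]. *)
  rewrite (fS 1%N n.+1) (fS 2%N n.+1) (fS 2%N n) (fS 3%N n.+1) (fS 3%N n).
  rewrite f0 !f4 !f5 w1 w2 w3 w4.
  (* Every power with an exponent depending on [n] is rewritten through [q ^+ n], which is then
     generalized so that [ring] sees a polynomial identity. *)
  have qM a b : q ^+ (a * b) = q ^+ b ^+ a by rewrite mulnC exprM.
  rewrite !exprD !qM !(exprS q n.+1) !(exprS q n).
  move: (c n) (c n.+1) (c n.+2) (d n) (d n.+1) (q ^+ n) => x y z a b p zE.
  rewrite mulrBr mulr1 {1}zE; ring.
(* The first coefficient of F_0 = F_1 + w_1^2 x F_2, used to eliminate [d 1] from the formula for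
   [c 2]. *)
have d1_eq : q ^+ 2 * d 1%N = c 1%N - 1.
  by have := fS 0%N 0%N; rewrite f0 f1 f_0 w1 => ->; ring.
have c1E := canRL (mulfK (q_ne 7%N)) c1_eq.
have d1E : d 1%N = (c 1%N - 1) / q ^+ 2.
  by rewrite -d1_eq mulrAC mulfV ?mul1r// expf_neq0// gt_eqF.
have q4_ne : 1 + q ^+ 4 != 0 by rewrite gt_eqF// addr_gt0// exprn_gt0.
split=> [k _|]; first by split; [exact: w_fin|exact: u_fin].
split; first by rewrite c1E; field; rewrite !q_ne.
split; last first.
  by move=> n _; rewrite addn2 addn1 mulrAC -c_eq mulfK// addnS q_ne.
(* The recurrence at [n = 0], where [c 0 = d 0 = 1], expresses [c 2] through [c 1] and [d 1]; its
   denominator is [1 - q ^+ 16]. *)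
apply: (mulIf (q_ne 15%N)); have := c_eq 0%N.
rewrite [c 0%N]shift_coef0 [d 0%N]shift_coef0 !muln0 !add0n => ->.
rewrite d1E c1E; field.
by rewrite !q_ne q4_ne gt_eqF.
Qed.
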